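(* Let $\mathscr{A},\mathscr{B}$ be unital $C^*$-algebras and let $\Phi:\mathscr{A}\to\mathscr{B}$ be a (not necessarily linear) unital $3$-positive map. If for some $A\in\mathscr{A}$ the equality $\Phi(A^*A)=\Phi(A)^*\Phi(A)$ holds, then $$\Phi(A^*X)=\Phi(A^* )\Phi(X)\quad\text{and}\quad \Phi(XA)=\Phi(X)\Phi(A)$$ for every $X\in\mathscr{A}$.
   Context: Maps between $C^*$-algebras are arbitrary functions; neither linearity nor continuity is assumed. A map $\Phi:\mathscr{A}\to\mathscr{B}$ is unital if $\mathscr{A},\mathscr{B}$ are unital and $\Phi(I)=I$ (both units are denoted $I$). A map is positive if it sends positive elements to positive elements. $\Phi$ is $n$-positive if the entrywise map $\Phi_n:M_n(\mathscr{A})\to M_n(\mathscr{B})$, $\Phi_n([a_{ij}])=[\Phi(a_{ij})]$, is positive, where $M_n(\mathscr{A})$ is the $C^*$-algebra of $n\times n$ matrices over $\mathscr{A}$. *)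

(* Defs.v *)
From HB Require Import structures.
From mathcomp Require Import all_boot all_order all_algebra.
From mathcomp Require Import complex.
From mathcomp Require Import all_classical reals topology normedtype.

Set Implicit Arguments.
Unset Strict Implicit.
Unset Printing Implicit Defensive.

Import Order.TTheory GRing.Theory Num.Theory.
Import numFieldNormedType.Exports.

Local Open Scope ring_scope.
Local Open Scope complex_scope.

(* Plain records rather than Hierarchy-Builder structures: numDomainType is
   already the join of rings and normed modules, so Hierarchy-Builder rejects a
   new structure inheriting from both.  A preBanachAlgebra is a complex Banach
   space with a ring structure on the same additive group; the compatibility of
   the product with scaling and with the norm is in unitalCStarAlgebra.  The
   ring is a pzRingType: the zero algebra is a unital C*-algebra too. *)
Record preBanachAlgebra (R : realType) := PreBanachAlgebra {
  prebanach_space : completeNormedModType R[i];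
  prebanach_isPzRing : GRing.Zmodule_isPzRing prebanach_space
}.

Definition prebanach_sort (R : realType) (A : preBanachAlgebra R) : Type :=
  prebanach_space A.

Coercion prebanach_sort : preBanachAlgebra >-> Sortclass.

HB.instance Definition _ (R : realType) (A : preBanachAlgebra R) :=
  CompleteNormedModule.copy (prebanach_sort A) (prebanach_space A).
HB.instance Definition _ (R : realType) (A : preBanachAlgebra R) :
  GRing.Zmodule_isPzRing (prebanach_sort A) := prebanach_isPzRing A.

(* The norm takes its values in R[i]: they are nonnegative, hence real. *)
Record unitalCStarAlgebra (R : realType) := UnitalCStarAlgebra {
  cstar_prebanach :> preBanachAlgebra R;
  star : cstar_prebanach -> cstar_prebanach;
  cstar_scalerAl : forall (k : R[i]) (x y : cstar_prebanach),
    k *: (x * y) = (k *: x) * y;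
  cstar_scalerAr : forall (k : R[i]) (x y : cstar_prebanach),
    k *: (x * y) = x * (k *: y);
  cstar_ler_normM : forall x y : cstar_prebanach, `|x * y| <= `|x| * `|y|;
  starK : involutive star;
  starD : {morph star : x y / x + y};
  starZ : forall (k : R[i]) (x : cstar_prebanach),
    star (k *: x) = k^* *: star x;
  starM : forall x y : cstar_prebanach, star (x * y) = star y * star x;
  cstar_normE : forall x : cstar_prebanach, `|star x * x| = `|x| ^+ 2
}.

Section MatrixPositivity.
Variables (R : realType) (A : unitalCStarAlgebra R).

Definition star_mx (m n : nat) (M : 'M[A]_(m, n)) : 'M[A]_(n, m) :=
  (map_mx (@star R A) M)^T.

(* The positive elements of the C*-algebra M_n(A) are those of the form N^* N;
   this involves only the *-algebra structure of M_n(A), not its C*-norm. *)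
Definition positive_mx (n : nat) (M : 'M[A]_n) : Prop :=
  exists N : 'M[A]_n, M = star_mx N *m N.

End MatrixPositivity.

Definition n_positive (R : realType) (A B : unitalCStarAlgebra R) (n : nat)
    (Phi : A -> B) : Prop :=
  forall M : 'M[A]_n, positive_mx M -> positive_mx (map_mx Phi M).

(* Main.v *)
Require Import Defs.
From mathcomp Require Import all_boot all_order all_algebra.
From mathcomp Require Import reals.
From mathcomp Require Import complex ring lra.
From mathcomp Require Import all_classical topology normedtype sequences.

Set Implicit Arguments.
Unset Strict Implicit.
Unset Printing Implicit Defensive.

Import Order.TTheory GRing.Theory Num.Theory.
Import numFieldNormedType.Exports.

Local Open Scope ring_scope.

(** Apply [Phi] entrywise to the Gram matrix of the row [(1, a, x)].  The result
is again of the form [N^* N]; write [n0], [n1], [n2] for the columns of [N] and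
[<u, v>] for the sum of the [u_k^* v_k].  Reading off entries gives
[<n0, n0> = 1], [<n0, n1> = Phi a], [<n0, n2> = Phi x] and
[<n1, n1> = Phi (a^* a)].  The hypothesis on [a] is the equality case of the
Cauchy-Schwarz inequality: the column [m = n1 - n0 Phi a] satisfies
[<m, m> = Phi (a^* a) - (Phi a)^* Phi a = 0].  If this forces [m = 0], then
[Phi (a^* x) = <n1, n2> = (Phi a)^* <n0, n2> = (Phi a)^* Phi x].  Since [Phi]
preserves the involution, the identity for [x a] is the adjoint of the one for
[a^* x^*].

What remains is a fact about a single C*-algebra, [sum_starM_eq0]: a vanishing
sum of elements [y_i^* y_i] has only zero terms.  It amounts to the theorem of
Fukamiya and Kaplansky that every [y^* y] is positive.  Here positivity of a
self-adjoint [x] is encoded by norms, as [`|t - x| <= t] for some [t >= 0], a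
condition that is plainly stable under sums, and the spectral theory is replaced
by three elementary tools.

- Square roots ([sqrt_exists]): [1 - z] with [`|z| < 1] is the square of [1 - l],
  where [l] is a fixed point of [l = (z + l^2) / 2].
- Normal elements: if [a], [b] are self-adjoint and commute, then
  [`|a + i b|^2 = `|a^2 + b^2|], so [`|a|^2 <= `|a^2 + b^2|].  Together with
  square roots this shows that self-adjoint squares are positive and that
  [a^2 <= 1] implies [`|a| <= 1].
- Growth ([nrm_le_of_growth]): a self-adjoint [x] satisfies
  [`|x^n| = `|x|^n] for [n] a power of two, so its norm is bounded by the
  exponential growth rate of its powers.

The growth argument shows that [y^* y <= 1] implies [y y^* <= 1]; as
[y^* y + y y^*] is twice the sum of the squares of the real and imaginary parts
of [y], this gives [`|y| <= 2], a bound that uses only an upper estimate of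
[y^* y] in the order ([nrm_le2]).  For [h = x^* x] with [`|x| < 1], write
[p = 1 - h = j^2] and apply the bound to [y = x j^m]: from
[1 - y^* y = 1 - (1 - p) p^m = (p - 1)^2 (1 + p + ... + p^(m-1)) + p],
a sum of squares, it follows that [`|(1 - p) p^m| <= 4] for every [m].  Hence
[`|p^n| <= 1 + 4 n], so [`|p| <= 1], which says that [h] is positive. *)

(** * Real sequences *)

Lemma geometric_lt (R : realType) (q K e : R) : 0 <= q < 1 -> 0 <= K -> 0 < e ->
  exists n, K * q ^+ n < e.
Proof.
move=> /andP[q0 q1] K0 e0.
have q1' : `|q| < 1 by rewrite ger0_norm.
have [n _ /(_ n (leqnn n)) /=] := cvgr0_norm_lt _ (cvg_geometric K q1') _ e0.
by exists n; apply: le_lt_trans (ler_norm _) _.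
Qed.

Lemma geometric_le0 (R : realType) (q K a : R) : 0 <= q < 1 -> 0 <= K ->
  (forall n, a <= K * q ^+ n) -> a <= 0.
Proof.
move=> q01 K0 aK; rewrite leNgt; apply/negP => a0.
by have [n] := geometric_lt q01 K0 a0; rewrite ltNge aK.
Qed.

(** Only exponents that are powers of two are at hand, because the identity
between the norm of a power and the power of the norm is used for them alone.
By Bernoulli, [X = 1 + d] gives [X ^ (2 N) >= (1 + N d)^2], which outgrows any
affine function of [N]. *)
Lemma le1_of_subexponential (R : realType) (X K : R) : 0 <= K ->
  (forall k, X ^+ (2 ^ k) <= 1 + (2 ^ k)%:R * K) -> X <= 1.
Proof.
move=> K0 XK; rewrite leNgt; apply/negP => X1.
pose d := X - 1; have d0 : 0 < d by rewrite subr_gt0.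
have bernoulli n : 1 + n%:R * d <= X ^+ n.
  have -> : X = 1 + d by rewrite /d addrC subrK.
  elim: n => [|n IHn]; first by rewrite mul0r addr0 expr0.
  have n0 : 0 <= n%:R :> R by [].
  have d1 : 0 <= 1 + d by lra.
  have := mulr_ge0 n0 (sqr_ge0 d); have := ler_wpM2l d1 IHn.
  by rewrite -exprS -natr1; lra.
pose k := Num.bound (2 * K / d ^+ 2).
have kK : 2 * K / d ^+ 2 < (2 ^ k)%:R.
  apply: lt_trans (archi_boundP _) _.
    by rewrite divr_ge0 ?sqr_ge0 ?mulr_ge0.
  by rewrite ltr_nat ltn_expl.
have := XK k.+1; rewrite expnSr exprM natrM.
move: kK; rewrite ltr_pdivrMr ?exprn_gt0 //.
have := bernoulli (2 ^ k)%N; set N := (2 ^ k)%:R; set Y := X ^+ (2 ^ k).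
have N0 : 0 < N by rewrite ltr0n expn_gt0.
move=> NY NK YN; have : (1 + N * d) ^+ 2 <= Y ^+ 2.
  by rewrite ler_sqr ?nnegrE //; nra.
nra.
Qed.

(** * Real-valued norm and involution *)

Section CStarAlgebra.
Context {R : realType} {A : unitalCStarAlgebra R}.
Implicit Types (x y z : A) (r s t : R).

Local Open Scope complex_scope.

(** The norm of the algebra takes values in [R[i]], whose order is partial; its
real part allows the arithmetic of [R]. *)
Definition nrm (x : A) : R := complex.Re `|x|.

Lemma nrmE x : `|x| = (nrm x)%:C.
Proof. by rewrite /nrm RRe_real // ger0_real. Qed.

Lemma nrm_ge0 x : 0 <= nrm x.
Proof. by rewrite -ler0c -nrmE. Qed.

Lemma nrmD x y : nrm (x + y) <= nrm x + nrm y.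
Proof. by have := ler_normD x y; rewrite !nrmE -rmorphD lecR. Qed.

Lemma nrmN x : nrm (- x) = nrm x.
Proof. by rewrite /nrm normrN. Qed.

Lemma nrmB x y : nrm (x - y) <= nrm x + nrm y.
Proof. by rewrite -[nrm y]nrmN nrmD. Qed.

Lemma nrmM x y : nrm (x * y) <= nrm x * nrm y.
Proof. by have := cstar_ler_normM x y; rewrite !nrmE -rmorphM lecR. Qed.

Lemma nrm0 : nrm 0 = 0.
Proof. by rewrite /nrm normr0. Qed.

Lemma nrm_eq0 x : nrm x = 0 -> x = 0.
Proof. by move=> nx0; apply/normr0_eq0; rewrite nrmE nx0. Qed.

Lemma nrmZ r x : nrm (r%:C *: x) = `|r| * nrm x.
Proof.
apply: (@complexI R); have := normrZ r%:C x; rewrite !nrmE => ->.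
by rewrite normc_def /= expr0n addr0 sqrtr_sqr rmorphM.
Qed.

Lemma nrmZ_ge0 r x : 0 <= r -> nrm (r%:C *: x) = r * nrm x.
Proof. by move=> r0; rewrite nrmZ ger0_norm. Qed.

Lemma star_nrmE x : nrm (star x * x) = nrm x ^+ 2.
Proof.
by apply: (@complexI R); have := cstar_normE x; rewrite !nrmE -rmorphXn.
Qed.

Lemma star0 : star 0 = 0 :> A.
Proof. by apply: (@addrI _ (star 0)); rewrite -starD !addr0. Qed.

Lemma starN x : star (- x) = - star x.
Proof. by apply: (@addrI _ (star x)); rewrite -starD !subrr star0. Qed.

Lemma starB x y : star (x - y) = star x - star y.
Proof. by rewrite starD starN. Qed.

Lemma star1 : star 1 = 1 :> A.
Proof. by rewrite -[LHS]mulr1 -{2}[1](@starK R A) -starM mulr1 starK. Qed.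

Lemma starZr r x : star (r%:C *: x) = r%:C *: star x.
Proof. by rewrite starZ conj_Creal // complex_real. Qed.

Lemma star_sum (I : finType) (F : I -> A) :
  star (\sum_i F i) = \sum_i star (F i).
Proof. by apply: (big_morph (@star R A) (@starD R A) star0). Qed.

(** The C*-identity and submultiplicativity give [`|x|^2 <= `|x^*| `|x|]. *)
Lemma nrm_star x : nrm (star x) = nrm x.
Proof.
have le y : nrm y <= nrm (star y).
  have := nrmM (star y) y; rewrite star_nrmE expr2.
  have [-> _|y0] := eqVneq (nrm y) 0; first exact: nrm_ge0.
  by rewrite ler_pM2r // lt_def y0 nrm_ge0.
by apply/eqP; rewrite eq_le le -{2}[x]starK le.
Qed.

Lemma nrm1_le1 : nrm 1 <= 1.
Proof.
have := star_nrmE 1; rewrite star1 mulr1 expr2 => n1.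
by have := nrm_ge0 1; nra.
Qed.

Definition selfadjoint x := star x = x.

Lemma selfadjoint1 : selfadjoint 1. Proof. exact: star1. Qed.

Lemma selfadjointD x y : selfadjoint x -> selfadjoint y -> selfadjoint (x + y).
Proof. by rewrite /selfadjoint starD => -> ->. Qed.

Lemma selfadjointB x y : selfadjoint x -> selfadjoint y -> selfadjoint (x - y).
Proof. by rewrite /selfadjoint starB => -> ->. Qed.

Lemma selfadjointZ r x : selfadjoint x -> selfadjoint (r%:C *: x).
Proof. by rewrite /selfadjoint starZr => ->. Qed.

Lemma selfadjointM x y : GRing.comm x y ->
  selfadjoint x -> selfadjoint y -> selfadjoint (x * y).
Proof. by rewrite /selfadjoint starM => -> -> ->. Qed.

Lemma selfadjointX x n : selfadjoint x -> selfadjoint (x ^+ n).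
Proof.
move=> sx; elim: n => [|n IHn]; first exact: selfadjoint1.
by rewrite exprS; apply: selfadjointM => //; apply: commrX.
Qed.

Lemma selfadjoint_starM x : selfadjoint (star x * x).
Proof. by rewrite /selfadjoint starM starK. Qed.

Lemma nrm_sqr x : selfadjoint x -> nrm (x ^+ 2) = nrm x ^+ 2.
Proof. by move=> sx; rewrite -star_nrmE sx. Qed.

Lemma nrmX2n x k : selfadjoint x -> nrm (x ^+ (2 ^ k)) = nrm x ^+ (2 ^ k).
Proof.
move=> sx; elim: k => [|k IHk]; first by rewrite !expr1.
by rewrite expnSr !exprM -IHk nrm_sqr //; apply: selfadjointX.
Qed.

Lemma scalerMM r s x y : (r%:C *: x) * (s%:C *: y) = (r * s)%:C *: (x * y).
Proof. by rewrite -cstar_scalerAl -cstar_scalerAr scalerA -rmorphM. Qed.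

Lemma scalerXr r x n : (r%:C *: x) ^+ n = (r ^+ n)%:C *: x ^+ n.
Proof.
elim: n => [|n IHn]; first by rewrite !expr0 scale1r.
by rewrite !exprS IHn scalerMM.
Qed.

Lemma commZ (k : R[i]) x y : GRing.comm x y -> GRing.comm x (k *: y).
Proof. by rewrite /GRing.comm -cstar_scalerAr -cstar_scalerAl => ->. Qed.

(** With [v = x + i y], commutation gives [v^* v = x^2 + y^2], hence
[`|v|^2 = `|x^2 + y^2|], and [x] is the mean of [v] and [v^*]. *)
Lemma nrm_le_sumsqr x y : selfadjoint x -> selfadjoint y -> GRing.comm x y ->
  nrm x ^+ 2 <= nrm (x ^+ 2 + y ^+ 2).
Proof.
move=> sx sy xy; set v := x + 'i *: y.
have sv : star v = x - 'i *: y.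
  rewrite /v starD starZ sx sy -scaleNr; congr (_ + _ *: _).
  exact: conjCi.
have -> : x ^+ 2 + y ^+ 2 = star v * v.
  rewrite sv /v mulrDr !mulrBl -!cstar_scalerAr -!cstar_scalerAl scalerA xy.
  by rewrite -['i * 'i]expr2 sqrCi scaleN1r opprK addrA subrK.
rewrite star_nrmE ler_sqr ?nnegrE ?nrm_ge0 //.
have : nrm (x + x) <= nrm v + nrm v.
  rewrite -{2}[nrm v]nrm_star (le_trans _ (nrmD _ _)) // sv /v.
  by rewrite addrACA subrr addr0.
have -> : x + x = (2 : R)%:C *: x by rewrite rmorphD scalerDl scale1r.
by rewrite nrmZ_ge0 //; lra.
Qed.

(** * Square roots *)

Lemma nrm_distC x y : nrm (x - y) = nrm (y - x).
Proof. by rewrite -nrmN opprB. Qed.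

(** Completeness, with an explicit rate so that no filter appears below. *)
Lemma geometric_cvg (b : nat -> A) q : 0 <= q < 1 ->
    (forall n, nrm (b n.+1 - b n) <= q ^+ n) ->
  exists l, forall n, (1 - q) * nrm (l - b n) <= q ^+ n.
Proof.
move=> q01 bq; have [q0 q1] := andP q01.
have q1' : 0 < 1 - q by lra.
have cauchyb n k : (1 - q) * nrm (b (n + k)%N - b n) <= q ^+ n - q ^+ (n + k).
  elim: k => [|k IHk]; first by rewrite addn0 !subrr nrm0 mulr0.
  have := nrmD (b (n + k).+1 - b (n + k)%N) (b (n + k)%N - b n).
  rewrite addrA subrK addnS exprS => le1.
  have := bq (n + k)%N; nra.
have /cvg_ex[l bl] : (cvg (b @ \oo))%classic.
  apply/cauchy_cvgP/cauchy_exP => e e0.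
  have eR : e = (complex.Re e)%:C by rewrite RRe_real // gtr0_real.
  have e0' : 0 < complex.Re e by move: e0; rewrite {1}eR ltcR.
  have [N qN] := geometric_lt q01 ler01 (mulr_gt0 q1' e0').
  exists (b N); exists N => // n /= /subnKC <-.
  rewrite -ball_normE /= nrmE eR ltcR nrm_distC -(ltr_pM2l q1').
  apply: le_lt_trans (cauchyb _ _) _; rewrite mul1r in qN.
  by have := exprn_ge0 (N + (n - N)) q0; lra.
exists l => n; apply/ler_addgt0Pr => e e0.
have eC0 : 0 < (e / (1 - q))%:C by rewrite ltcR divr_gt0.
have [M _ /(_ (n + M)%N (leq_addl _ _)) /=] := cvgr_dist_le _ _ bl _ eC0.
rewrite nrmE lecR ler_pdivlMr // => le1.
have := nrmD (l - b (n + M)%N) (b (n + M)%N - b n).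
rewrite addrA subrK; have := cauchyb n M.
by have := exprn_ge0 (n + M) q0; nra.
Qed.

(** The map [l |-> (z + l^2) / 2] preserves the ball of radius [q = `|z|],
because [q + q^2 <= 2 q], and on commuting elements of that ball it contracts
distances by [q].  All iterates from [0] are polynomials in [z], so what commutes
with [z] commutes with the limit. *)
Lemma sqrt_iteration_limit z : selfadjoint z -> nrm z < 1 ->
  exists l, [/\ selfadjoint l, forall w, GRing.comm w z -> GRing.comm w l
    & l + l = z + l ^+ 2].
Proof.
move=> sz; set q := nrm z => q1; have q0 : 0 <= q := nrm_ge0 z.
have q01 : 0 <= q < 1 by rewrite q0.
pose b := fix b n : A := if n is n'.+1 then (2^-1)%:C *: (z + b n' ^+ 2) else 0.
have half : 0 <= (2 : R)^-1 by lra.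
have bS n : b n.+1 + b n.+1 = z + b n ^+ 2.
  rewrite -scalerDl -rmorphD.
  have -> : (2 : R)^-1 + 2^-1 = 1 by lra.
  by rewrite rmorph1 scale1r.
have sb n : selfadjoint (b n).
  elim: n => [|n IHn]; first exact: star0.
  exact/selfadjointZ/selfadjointD/selfadjointX.
have cb w n : GRing.comm w z -> GRing.comm w (b n).
  move=> wz; elim: n => [|n IHn]; first exact: commr0.
  exact/commZ/commrD/commrX.
have nb n : nrm (b n) <= q.
  elim: n => [|n IHn]; first by rewrite nrm0.
  rewrite nrmZ_ge0 //; have := nrmD z (b n ^+ 2).
  by have := nrm_ge0 (b n); rewrite nrm_sqr // -/q; nra.
have db n : nrm (b n.+1 - b n) <= q ^+ n.
  elim: n => [|n IHn].
    rewrite /b /= subr0 expr0n addr0 nrmZ_ge0 //.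
    by rewrite expr0 -/q; lra.
  have -> : b n.+2 - b n.+1 =
      (2^-1)%:C *: ((b n.+1 - b n) * (b n.+1 + b n)).
    rewrite mulrDr !mulrBl (cb (b n)) ?addrA ?subrK -?expr2; last first.
      exact/commr_sym/cb.
    by rewrite -scalerBr opprD addrACA subrr add0r.
  rewrite nrmZ_ge0 // exprSr.
  have := nrmM (b n.+1 - b n) (b n.+1 + b n).
  have := nrmD (b n.+1) (b n); have := nb n; have := nb n.+1.
  have := nrm_ge0 (b n.+1 - b n); have := nrm_ge0 (b n.+1 + b n); nra.
have [l bl] := geometric_cvg q01 db.
have lim0' x K : 0 <= K ->
    (forall n, (1 - q) * nrm x <= K * q ^+ n) -> x = 0.
  move=> K0 xK; apply: nrm_eq0; apply/eqP; rewrite eq_le nrm_ge0 andbT.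
  suff : (1 - q) * nrm x <= 0 by rewrite pmulr_rle0 // subr_gt0.
  exact: (geometric_le0 q01 K0).
have lim0 x K : 0 <= K ->
    (forall n, nrm x <= K * nrm (l - b n)) -> x = 0.
  move=> K0 xK; apply: (lim0' _ K) => // n; have := xK n; have := bl n; nra.
exists l; split.
- apply/eqP; rewrite -subr_eq0; apply/eqP/(lim0 _ 2) => // n.
  have -> : star l - l = star (l - b n) - (l - b n).
    by rewrite starB sb opprB addrA subrK.
  have := nrmB (star (l - b n)) (l - b n); rewrite nrm_star; lra.
- move=> w wz; apply/eqP; rewrite -subr_eq0; apply/eqP.
  apply/(lim0 _ (2 * nrm w)) => [|n]; first by rewrite mulr_ge0 // nrm_ge0.
  have -> : w * l - l * w = w * (l - b n) - (l - b n) * w.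
    by rewrite mulrBr mulrBl (cb w n wz) opprB addrA subrK.
  have := nrmB (w * (l - b n)) ((l - b n) * w).
  have := nrmM w (l - b n); have := nrmM (l - b n) w; lra.
- apply/eqP; rewrite -subr_eq0; apply/eqP/(lim0' _ (3 + nrm l)) => [|n].
    by rewrite addr_ge0 // nrm_ge0.
  (* The recursion [2 b_(n+1) = z + b_n^2] turns the defect of [l] into terms
     that contain a factor [l - b_n] or [l - b_(n+1)]. *)
  have -> : l + l - (z + l ^+ 2) =
      (l - b n.+1 + (l - b n.+1)) - (l * (l - b n) + (l - b n) * b n).
    rewrite addrACA -opprD bS mulrBr mulrBl addrA subrK -!expr2.
    by rewrite [in RHS]opprB !opprD !addrA subrK.
  have := nrmB (l - b n.+1 + (l - b n.+1)) (l * (l - b n) + (l - b n) * b n).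
  have := nrmD (l - b n.+1) (l - b n.+1).
  have := nrmD (l * (l - b n)) ((l - b n) * b n).
  have := nrmM l (l - b n); have := nrmM (l - b n) (b n).
  have := bl n; have := bl n.+1; have := nb n; rewrite exprS.
  have := exprn_ge0 n q0; have := nrm_ge0 l; have := nrm_ge0 (l - b n).
  set u := nrm l; set v := nrm (l - b n); set w := nrm (l - b n.+1).
  set Q := q ^+ n; set B := nrm (b n) => v0 u0 Q0 Bq wQ vQ h1 h2 h3 h4 h5.
  have h6 : v * B <= v by rewrite ler_piMr // (le_trans Bq) // ltW.
  have h7 : u * ((1 - q) * v) <= u * Q by rewrite ler_wpM2l.
  have h8 : q * Q <= Q by rewrite ler_piMl // ltW.
  set N := nrm _ in h5 *.
  have h9 : N <= w + w + (u * v + v) by lra.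
  have : (1 - q) * N <= (1 - q) * (w + w + (u * v + v)).
    by rewrite ler_wpM2l // subr_ge0 ltW.
  by lra.
Qed.

Definition runit r : A := r%:C *: (1 : A).

Lemma runitD r s : runit (r + s) = runit r + runit s.
Proof. by rewrite /runit rmorphD scalerDl. Qed.

Lemma runit1 : runit 1 = 1.
Proof. by rewrite /runit rmorph1 scale1r. Qed.

Lemma runitZ r s : r%:C *: runit s = runit (r * s).
Proof. by rewrite /runit scalerA rmorphM. Qed.

Lemma runit_comm r x : GRing.comm x (runit r).
Proof. exact/commZ/commr1. Qed.

Lemma runit_selfadjoint r : selfadjoint (runit r).
Proof. exact/selfadjointZ/selfadjoint1. Qed.

Lemma nrm_runit_le r : 0 <= r -> nrm (runit r) <= r.
Proof. by move=> r0; rewrite nrmZ_ge0 // ler_piMr // nrm1_le1. Qed.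

(** Rescale to [z = 1 - x / t], of norm less than one; if [2 l = z + l^2] then
[(1 - l)^2 = 1 - z = x / t]. *)
Lemma sqrt_exists x t : selfadjoint x -> nrm (runit t - x) < t ->
  exists y, [/\ selfadjoint y, y ^+ 2 = x
    & forall w, GRing.comm w x -> GRing.comm w y].
Proof.
move=> sx xt; have t0 : 0 < t := le_lt_trans (nrm_ge0 _) xt.
pose z := t^-1%:C *: (runit t - x).
have sz : selfadjoint z.
  exact/selfadjointZ/selfadjointB/sx/runit_selfadjoint.
have z1 : nrm z < 1.
  by rewrite nrmZ_ge0 ?invr_ge0 ?ltW // mulrC ltr_pdivrMr // mul1r.
have [l [sl cl lz]] := sqrt_iteration_limit sz z1.
exists ((Num.sqrt t)%:C *: (1 - l)); split.
- exact/selfadjointZ/selfadjointB/sl/selfadjoint1.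
- rewrite scalerXr sqr_sqrtr ?ltW //.
  have -> : (1 - l) ^+ 2 = 1 - z.
    rewrite expr2 mulrBr mulr1 mulrBl mul1r -expr2 -addrA -opprD addrA.
    by rewrite lz addrK.
  rewrite scalerBr /z scalerA -rmorphM divff ?gt_eqF // rmorph1 scale1r.
  by rewrite opprB addrC subrK.
- move=> w wx; apply/commZ/commrB/cl; first exact: commr1.
  by apply/commZ/commrB/wx/runit_comm.
Qed.

(** * The positive cone *)

(** For self-adjoint [x] the bound says that the spectrum of [x] lies between [0]
and [2 t].  Self-adjointness is left as a separate hypothesis. *)
Definition nonneg x := exists2 t, 0 <= t & nrm (runit t - x) <= t.

Lemma nonnegD x y : nonneg x -> nonneg y -> nonneg (x + y).
Proof.
move=> [t t0 xt] [s s0 ys]; exists (t + s); first exact: addr_ge0.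
by rewrite runitD opprD addrACA (le_trans (nrmD _ _)) // lerD.
Qed.

Lemma nonneg_runit t : 0 <= t -> nonneg (runit t : A).
Proof. by move=> t0; exists t; rewrite // subrr nrm0. Qed.

Lemma nonneg0 : nonneg 0.
Proof. by exists 0 => //; rewrite subr0 nrm_runit_le. Qed.

Lemma nonneg_sum (I : finType) (P : pred I) (F : I -> A) :
  (forall i, P i -> nonneg (F i)) -> nonneg (\sum_(i | P i) F i).
Proof. by apply: big_ind => //; [exact: nonneg0 | exact: nonnegD]. Qed.

Lemma nonnegZ r x : 0 <= r -> nonneg x -> nonneg (r%:C *: x).
Proof.
move=> r0 [t t0 xt]; exists (r * t); first exact: mulr_ge0.
by rewrite -runitZ -scalerBr nrmZ_ge0 // ler_wpM2l.
Qed.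

(** Choose [t > `|x^2|] and let [y^2 = t - x^2].  Since [x^2 + y^2 = t],
the norm of [t - x^2 = y^2] is at most [t]. *)
Lemma nonneg_sqr x : selfadjoint x -> nonneg (x ^+ 2).
Proof.
move=> sx; pose t := nrm x ^+ 2 + 1.
have t0 : 0 <= t by rewrite addr_ge0 ?sqr_ge0.
have sc : selfadjoint (runit t - x ^+ 2).
  exact/selfadjointB/selfadjointX/sx/runit_selfadjoint.
have ct : nrm (runit t - (runit t - x ^+ 2)) < t.
  by rewrite opprB addrC subrK nrm_sqr // /t; lra.
have [y [sy yx cy]] := sqrt_exists sc ct.
exists t => //; rewrite -yx nrm_sqr //.
have xy : GRing.comm y x.
  by apply/commr_sym/cy/commrB/commrX/commr_refl/runit_comm.
have := nrm_le_sumsqr sy sx xy; rewrite yx subrK => /le_trans; apply.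
exact: nrm_runit_le.
Qed.

(** If [1 - x^2] had a square root [y], then [`|x|^2 <= `|x^2 + y^2| <= 1];
[1 - x^2 + e] has one for every [e > 0]. *)
Lemma nrm_le1_of_sqr x : selfadjoint x -> nonneg (1 - x ^+ 2) -> nrm x <= 1.
Proof.
move=> sx [t t0 xt]; suff : nrm x ^+ 2 <= 1.
  by have := nrm_ge0 x; nra.
apply/ler_addgt0Pr => e e0.
have sc : selfadjoint (1 - x ^+ 2 + runit e).
  apply/selfadjointD/runit_selfadjoint.
  exact/selfadjointB/selfadjointX/sx/selfadjoint1.
have ct : nrm (runit (t + e) - (1 - x ^+ 2 + runit e)) < t + e.
  by rewrite runitD opprD addrACA subrr addr0 (le_lt_trans xt) ?ltrDl.
have [y [sy yx cy]] := sqrt_exists sc ct.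
have xy : GRing.comm x y.
  apply/cy/commrD/runit_comm/commrB/commrX/commr_refl; exact: commr1.
have := nrm_le_sumsqr sx sy xy; rewrite yx addrA [_ + (1 - _)]addrC subrK.
move=> /le_trans; apply; rewrite (le_trans (nrmD _ _)) // lerD ?nrm1_le1 //.
exact/nrm_runit_le/ltW.
Qed.

(** The C*-algebra form of the fact that the norm of a self-adjoint element is
its spectral radius. *)
Lemma nrm_le_of_growth x t K : selfadjoint x -> 0 < t -> 0 <= K ->
  (forall n, nrm (x ^+ n) <= t ^+ n * (1 + n%:R * K)) -> nrm x <= t.
Proof.
move=> sx t0 K0 xK; rewrite -[t]mul1r -ler_pdivrMr //.
apply: (le1_of_subexponential K0) => k.
by rewrite expr_div_n -nrmX2n // ler_pdivrMr ?exprn_gt0 // mulrC.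
Qed.

(** [y^* y] and [y y^*] have the same spectrum up to [0].  In terms of powers:
with [u = t + y^* y] and [w = t + y y^*], the relation [w y = y u] gives
[w^(n+1) = t w^n + y u^n y^*], so a bound [s^n] on the powers of [u] carries
over to [w] up to a factor affine in [n]. *)
Lemma nonneg_1B_swap y :
  nonneg (1 - star y * y) -> nonneg (1 - y * star y).
Proof.
move=> [t t0 yt].
(* The hypothesis bounds [t - 1 + y^* y]; adding 1 makes the constant in [w]
   the nonnegative [t], as the recursion for [w ^+ n] requires. *)
pose s := t + 1.
pose w := runit t + y * star y; pose u := runit t + star y * y.
have us : nrm u <= s.
  have -> : u = runit t - (1 - star y * y) + 1 by rewrite opprB -addrA subrK.
  by rewrite (le_trans (nrmD _ _)) // lerD // nrm1_le1.
have sw : selfadjoint w.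
  apply/selfadjointD; first exact: runit_selfadjoint.
  by rewrite /selfadjoint starM starK.
have un n : nrm (u ^+ n) <= s ^+ n.
  elim: n => [|n IHn]; first exact: nrm1_le1.
  by rewrite !exprS (le_trans (nrmM _ _)) // ler_pM ?nrm_ge0.
have wy n : w ^+ n * y = y * u ^+ n.
  elim: n => [|n IHn]; first by rewrite mulr1 mul1r.
  rewrite exprSr -mulrA.
  have -> : w * y = y * u.
    by rewrite mulrDl mulrDr mulrA [y * runit t]runit_comm.
  by rewrite mulrA IHn -mulrA -exprSr.
exists s; first by rewrite addr_ge0.
have -> : runit s - (1 - y * star y) = w.
  by rewrite runitD runit1 opprB [y * _ - 1]addrC addrA addrK.
apply: (@nrm_le_of_growth _ _ (nrm y ^+ 2)) => //.
- by rewrite ltr_wpDl.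
- exact: sqr_ge0.
elim=> [|n IHn]; first by rewrite mul0r addr0 mulr1 nrm1_le1.
have -> : w ^+ n.+1 = t%:C *: w ^+ n + y * u ^+ n * star y.
  by rewrite exprSr {2}/w mulrDr -cstar_scalerAr mulr1 mulrA wy.
have := nrmD (t%:C *: w ^+ n) (y * u ^+ n * star y).
rewrite nrmZ_ge0 //.
have := nrmM (y * u ^+ n) (star y); have := nrmM y (u ^+ n).
rewrite nrm_star exprS -natr1; have := un n; move: IHn.
have : 0 <= s ^+ n by rewrite exprn_ge0 // addr_ge0.
have : 0 <= n%:R :> R by [].
rewrite {4}/s.
have := nrm_ge0 y; set Y := nrm y; set N := n%:R; set Q := s ^+ n.
set W := nrm (w ^+ n); set U := nrm (u ^+ n); set V := nrm (y * _).
move=> Y0 N0 Q0 WQ UQ VU h1 h2.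
have : V * Y <= Y ^+ 2 * Q.
  rewrite expr2 -mulrA [Y * Q]mulrC mulrA ler_wpM2r // (le_trans VU) //.
  exact: ler_wpM2l.
have : t * W <= t * (Q * (1 + N * Y ^+ 2)) by rewrite ler_wpM2l.
have := mulr_ge0 t0 (mulr_ge0 Q0 (sqr_ge0 Y)).
have := mulr_ge0 Q0 (mulr_ge0 N0 (sqr_ge0 Y)).
lra.
Qed.

(** * Elements of the form [star x * x] *)

Lemma sqrD_subsqrB x y :
  (x + y) ^+ 2 - (x - y) ^+ 2 = (2 : R)%:C *: (x * y + y * x).
Proof.
rewrite rmorphD scalerDl rmorph1 scale1r !expr2 mulrDl mulrBl !mulrDr !mulrN.
rewrite !opprD !opprK addrACA [x * x + _ + _]addrACA subrr add0r.
by rewrite [y * x + _ + _]addrACA subrr addr0 addrACA.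
Qed.

Lemma sqrZi x : ('i *: x) ^+ 2 = - x ^+ 2.
Proof.
rewrite !expr2 -cstar_scalerAl -cstar_scalerAr scalerA.
by rewrite -['i * 'i]expr2 sqrCi scaleN1r.
Qed.

(** Let [a] be the real part of [y] and [- b] its imaginary part.  Then
[2 (a^2 + b^2) = y^* y + y y^* <= 2], so [1 - a^2] is positive because [b^2] is,
and [nrm_le1_of_sqr] bounds [a]. *)
Lemma nrm_addstar_le2 y : nonneg (1 - star y * y) -> nrm (y + star y) <= 2.
Proof.
move=> yy; have yy' := nonneg_1B_swap yy.
pose a := (2^-1)%:C *: (y + star y).
pose b := (2^-1)%:C *: ('i *: (y - star y)).
have sa : selfadjoint a.
  by apply: selfadjointZ; rewrite /selfadjoint starD starK addrC.
have sb : selfadjoint b.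
  apply: selfadjointZ; rewrite /selfadjoint starZ starB starK.
  have -> : Num.conj 'i = - 'i :> R[i] by exact: conjCi.
  by rewrite scaleNr -scalerN opprB.
have ab : a ^+ 2 + b ^+ 2 = (2^-1)%:C *: (star y * y + y * star y).
  rewrite !scalerXr sqrZi scalerN -scalerBr sqrD_subsqrB scalerA -rmorphM.
  rewrite [star y * y + _]addrC.
  by have -> : (2^-1 : R) ^+ 2 * 2 = 2^-1 by field.
suff a1 : nrm a <= 1.
  by move: a1; rewrite nrmZ_ge0 ?invr_ge0 //; lra.
apply: nrm_le1_of_sqr => //.
have -> : 1 - a ^+ 2 = b ^+ 2 +
    ((2^-1)%:C *: (1 - star y * y) + (2^-1)%:C *: (1 - y * star y)).
  rewrite -scalerDr addrACA -opprD scalerBr -ab [a ^+ 2 + _]addrC opprD.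
  have -> : (2^-1)%:C *: (1 + 1 : A) = 1.
    rewrite scalerDr -scalerDl -rmorphD.
    by have -> : (2 : R)^-1 + 2^-1 = 1; [lra | rewrite rmorph1 scale1r].
  by rewrite addrCA [b ^+ 2 + _]addrA subrr add0r.
apply: nonnegD; first exact: nonneg_sqr.
by apply: nonnegD; apply: nonnegZ; rewrite ?invr_ge0.
Qed.

(** The previous bound applies to [y] and to [i y], hence to twice the real and
twice the imaginary part of [y]. *)
Lemma nrm_le2 y : nonneg (1 - star y * y) -> nrm y <= 2.
Proof.
move=> yy; have yr := nrm_addstar_le2 yy.
have yi : nrm ('i *: (y - star y)) <= 2.
  have iC : Num.conj 'i = - 'i :> R[i] by exact: conjCi.
  have -> : 'i *: (y - star y) = 'i *: y + star ('i *: y).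
    by rewrite starZ iC scaleNr scalerBr.
  apply: nrm_addstar_le2.
  rewrite starZ iC -cstar_scalerAl -cstar_scalerAr scalerA.
  by rewrite mulNr -['i * 'i]expr2 sqrCi opprK scale1r.
have : nrm ((2 : R)%:C *: y) <=
    nrm (y + star y) + nrm (- 'i *: ('i *: (y - star y))).
  rewrite (le_trans _ (nrmD _ _)) // scalerA mulNr -['i * 'i]expr2 sqrCi opprK.
  by rewrite scale1r addrACA subrr addr0 rmorphD scalerDl scale1r.
have -> : nrm (- 'i *: ('i *: (y - star y))) = nrm ('i *: (y - star y)).
  apply: (@complexI R); rewrite -!nrmE.
  by rewrite normrZ normrN normCi mul1r.
rewrite nrmZ_ge0 //; lra.
Qed.

(** Every multiple of [y] satisfies the hypothesis of [nrm_le2]; a factor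
[3 / `|y|] would contradict its conclusion. *)
Lemma eq0_of_nonnegN y : nonneg (- (star y * y)) -> y = 0.
Proof.
move=> yy; apply: nrm_eq0; apply/eqP; rewrite eq_le nrm_ge0 andbT leNgt.
apply/negP => y0; have r0 : 0 <= 3 / nrm y by rewrite divr_ge0 // ltW.
have : nrm ((3 / nrm y)%:C *: y) <= 2.
  apply: nrm_le2; rewrite starZr scalerMM -scalerN.
  apply: nonnegD; first by rewrite -runit1; apply: nonneg_runit.
  by apply: nonnegZ => //; rewrite mulr_ge0.
by rewrite nrmZ_ge0 // divfK ?gt_eqF //; lra.
Qed.

(** If the spectrum of [p = 1 - x^* x] reached beyond [1], the elements
[x p^(m/2)] would concentrate on it and make [y^* y = (1 - p) p^m] very negative
while it stays below [1], against [nrm_le2].  The square root [j] of [p] supplies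
the odd powers. *)
Lemma nonneg_starM_lt1 x : nrm x < 1 -> nonneg (star x * x).
Proof.
move=> x1; set h := star x * x; pose p := 1 - h.
have sh : selfadjoint h := selfadjoint_starM x.
have sp : selfadjoint p by apply/selfadjointB/sh/selfadjoint1.
have hE : h = 1 - p by rewrite /p opprB addrC subrK.
have p1 : nrm (runit 1 - p) < 1.
  rewrite runit1 -hE star_nrmE; have := nrm_ge0 x; nra.
have [j [sj jp cj]] := sqrt_exists sp p1.
have jh : GRing.comm h j.
  by apply/cj/commrB/commr_refl/commr1.
have pj : GRing.comm p j by apply/cj/commr_refl.
have cj1 i : GRing.comm (j ^+ i) (p - 1).
  by apply: commrB; [apply/commr_sym/commrX | exact: commr1].
have cp1 i : GRing.comm (p ^+ i) (p - 1).
  by apply: commrB; [apply/commr_sym/commrX/commr_refl | exact: commr1].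
have ineq m : nrm (h * p ^+ m) <= 4.
  have yy : star (x * j ^+ m) * (x * j ^+ m) = h * p ^+ m.
    rewrite starM (selfadjointX m sj) mulrA -[_ * star x * x]mulrA -/h.
    by rewrite -(commrX m jh) -mulrA -exprD addnn -mul2n exprM jp.
  rewrite -yy star_nrmE.
  suff : nrm (x * j ^+ m) <= 2 by have := nrm_ge0 (x * j ^+ m); nra.
  apply: nrm_le2; rewrite yy.
  have -> : 1 - h * p ^+ m = \sum_(i < m) (j ^+ i * (p - 1)) ^+ 2 + p.
    have -> : \sum_(i < m) (j ^+ i * (p - 1)) ^+ 2 = (p - 1) * (p ^+ m - 1).
      rewrite subrX1 mulrA -expr2 mulr_sumr; apply: eq_bigr => i _.
      by rewrite exprMn_comm // -exprM mulnC exprM jp; apply/commrX.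
    by rewrite mulrBr mulr1 opprB -addrA subrK addrC hE -mulNr opprB.
  apply: nonnegD; last by rewrite -jp; apply: nonneg_sqr.
  apply: nonneg_sum => i _; apply/nonneg_sqr/selfadjointM.
  - exact: cj1.
  - exact: selfadjointX.
  - exact/selfadjointB/selfadjoint1.
(* The bound [ineq] says that consecutive powers of [p] differ by at most 4. *)
exists 1 => //; rewrite runit1 -/p.
apply: (nrm_le_of_growth (K := 4)) => // n; rewrite expr1n mul1r.
elim: n => [|n IHn]; first by rewrite mul0r addr0 nrm1_le1.
have -> : p ^+ n.+1 = p ^+ n - h * p ^+ n by rewrite exprS {1}/p mulrBl mul1r.
by have := nrmB (p ^+ n) (h * p ^+ n); have := ineq n; rewrite -natr1; lra.
Qed.

Lemma nonneg_starM x : nonneg (star x * x).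
Proof.
pose t := nrm x + 1; have t0 : 0 < t by have := nrm_ge0 x; rewrite /t; lra.
have -> : star x * x = (t ^+ 2)%:C *: (star (t^-1%:C *: x) * (t^-1%:C *: x)).
  rewrite starZr scalerMM scalerA -rmorphM -expr2 exprVn.
  by rewrite divff ?rmorph1 ?scale1r // expf_neq0 // gt_eqF.
apply/nonnegZ/nonneg_starM_lt1; first exact: sqr_ge0.
by rewrite nrmZ_ge0 ?invr_ge0 ?ltW // mulrC ltr_pdivrMr // /t mul1r ltrDl.
Qed.

Lemma sum_starM_eq0 (I : finType) (F : I -> A) :
  \sum_i star (F i) * F i = 0 -> forall i, F i = 0.
Proof.
move=> F0 i; apply: eq0_of_nonnegN; move: F0; rewrite (bigD1 i) //=.
move=> /eqP; rewrite addrC addr_eq0 => /eqP <-.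
by apply: nonneg_sum => k _; apply: nonneg_starM.
Qed.

End CStarAlgebra.

(** * Nonlinear positive maps *)

Section PositiveMaps.
Context {R : realType} {A B : unitalCStarAlgebra R} {Phi : A -> B}.

(** The matrix [V] whose first row is [v] and whose other rows vanish satisfies
[V^* V = (v_i^* v_j)]. *)
Lemma n_positive_gram n (v : 'I_n.+1 -> A) : n_positive n.+1 Phi ->
  exists N : 'M[B]_n.+1,
    forall i j, Phi (star (v i) * v j) = \sum_k star (N k i) * N k j.
Proof.
pose V := \matrix_(k < n.+1, j < n.+1) (if k == ord0 then v j else 0).
move=> /(_ (star_mx V *m V)) [|N MN]; first by exists V.
exists N => i j; move/matrixP: MN => /(_ i j); rewrite !mxE.
rewrite big_ord_recl big1 => [|k _]; rewrite !mxE ?mulr0 //= addr0 => ->.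
by apply: eq_bigr => k _; rewrite !mxE.
Qed.

(** [y^*] and [y] occupy transposed entries of the Gram matrix of [(1, y, ..., y)],
whose image is Hermitian. *)
Lemma n_positive_star n (y : A) : n_positive n.+2 Phi ->
  Phi (star y) = star (Phi y).
Proof.
pose v (i : 'I_n.+2) := if i == ord0 then 1 else y.
move=> /(n_positive_gram v)[N NE].
have := NE ord_max ord0; have := NE ord0 ord_max.
rewrite /v /= star1 mul1r mulr1 => -> ->.
by rewrite star_sum; apply: eq_bigr => k _; rewrite starM starK.
Qed.

(** The equality case of Cauchy-Schwarz for the columns of [N]. *)
Lemma n_positive3_mul (a x : A) : n_positive 3 Phi -> Phi 1 = 1 ->
    Phi (star a * a) = star (Phi a) * Phi a ->
  Phi (star a * x) = star (Phi a) * Phi x.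
Proof.
move=> Phi3 Phi1 Phia.
pose v (i : 'I_3) := nth 0 [:: 1; a; x] i.
have [N NE] := n_positive_gram v Phi3.
pose i0 : 'I_3 := inord 0; pose i1 : 'I_3 := inord 1; pose i2 : 'I_3 := inord 2.
have [v0 v1 v2] : [/\ v i0 = 1, v i1 = a & v i2 = x] by rewrite /v !inordK.
have N00 : \sum_k star (N k i0) * N k i0 = 1.
  by rewrite -NE v0 star1 mulr1.
have N01 : \sum_k star (N k i0) * N k i1 = Phi a.
  by rewrite -NE v0 v1 star1 mul1r.
have N02 : \sum_k star (N k i0) * N k i2 = Phi x.
  by rewrite -NE v0 v2 star1 mul1r.
have N11 : \sum_k star (N k i1) * N k i1 = star (Phi a) * Phi a.
  by rewrite -NE v1.
have N10 : \sum_k star (N k i1) * N k i0 = star (Phi a).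
  by rewrite -N01 star_sum; apply: eq_bigr => k _; rewrite starM starK.
have N12 : Phi (star a * x) = \sum_k star (N k i1) * N k i2.
  by rewrite -NE v1 v2.
have NkE k : N k i1 = N k i0 * Phi a.
  apply/eqP; rewrite -subr_eq0; apply/eqP; move: k.
  apply: sum_starM_eq0.
  under eq_bigr => k _
    do rewrite starB starM mulrBl !mulrBr !mulrA -!(mulrA (star (Phi a))).
  rewrite !sumrB -!mulr_sumr -!mulr_suml N11 N10 N00 N01 mul1r.
  by rewrite !subrr.
rewrite N12 -N02 mulr_sumr; apply: eq_bigr => k _.
by rewrite NkE starM mulrA.
Qed.

End PositiveMaps.

Theorem theorem3p2 (R : realType) (A B : unitalCStarAlgebra R) (Phi : A -> B)
    (Phi_unital : Phi 1 = 1) (Phi_3pos : n_positive 3 Phi)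
    (a : A) (Phi_a : Phi (star a * a) = star (Phi a) * Phi a) :
  forall x : A,
    Phi (star a * x) = Phi (star a) * Phi x /\ Phi (x * a) = Phi x * Phi a.
Proof.
have PhiS y : Phi (star y) = star (Phi y) := n_positive_star y Phi_3pos.
have Phi_mul x := n_positive3_mul x Phi_3pos Phi_unital Phi_a.
move=> x; split; first by rewrite PhiS.
by rewrite -[x * a]starK starM PhiS Phi_mul starM -PhiS !starK.
Qed.
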